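(* Let $r,m$ be positive integers with $r\ge3$ and $r\mid m$, let $p$ be a prime, $q=p^m$, and let $k\ge3$, $t\ge1$, $h\ge0$ be integers with $t+h\le k-1$. Let $\eta\in\mathbb{F}_{p^m}\setminus\mathbb{F}_{p^r}$. Suppose that $n$ (with $k<n$), $\boldsymbol{\alpha}$, $\boldsymbol{v}$ are as in one of the following two situations. (A) $n=p^r$, $\boldsymbol{\alpha}=(\alpha_{i_1},\ldots,\alpha_{i_n})$ with $\{\alpha_{i_1},\ldots,\alpha_{i_n}\}=\mathbb{F}_{p^r}$, $\boldsymbol{v}=\boldsymbol{1}$, and one of the following holds: $t=1$ and $2k+t+2=p^r$; or $t$ is odd with $t\ge3$ and $2k+t=p^r$; or $t=2$ and $2k+t+3=p^r$; or $t$ is even with $t\ge4$ and $2k+t+1=p^r$. (B) $p=2$, $n=2^r-1$, $\boldsymbol{\alpha}=(\alpha_{i_1},\ldots,\alpha_{i_n})$ with $\{\alpha_{i_1},\ldots,\alpha_{i_n}\}=\mathbb{F}_{2^r}^{*}$, $\boldsymbol{v}=(v_1,\ldots,v_n)$ with $v_j=\prod_{\beta\in\mathbb{F}_{2^m}\setminus\mathbb{F}_{2^r}^{*}}(\alpha_{i_j}-\beta)^{2^{m-1}}$, and one of the following holds: $t=2$ and $2k+t+3=2^r-1$; or $t$ is even with $t\ge4$ and $2k+t+1=2^r-1$; or $t=1$ and $2k+t+2=2^r-1$; or $t$ is odd with $t\ge3$ and $2k+t=2^r-1$. Then $\mathcal{C}_{\mathcal{V}_{k,t,h,\eta}}(\boldsymbol{\alpha},\boldsymbol{v})$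 is a non-GRS self-orthogonal MDS code.
   Context: $\boldsymbol{1}=(1,\ldots,1)$. For $h\le k-1$ and $\eta\in\mathbb{F}_q^*=\mathbb{F}_q\setminus\{0\}$, $$\mathcal{V}_{k,t,h,\eta}=\Big\{\sum_{i=0}^{k-1}a_ix^i+\eta a_hx^{k-1+t}\ \Big|\ a_0,\ldots,a_{k-1}\in\mathbb{F}_q\Big\}.$$ For a linear subspace $\mathcal{V}\subseteq\mathbb{F}_q[x]$, $\boldsymbol{\alpha}=(\alpha_{i_1},\ldots,\alpha_{i_n})$ with pairwise distinct entries in $\mathbb{F}_q$ and $\boldsymbol{v}\in(\mathbb{F}_q^* )^n$, $$\mathcal{C}_{\mathcal{V}}(\boldsymbol{\alpha},\boldsymbol{v})=\{(v_1f(\alpha_{i_1}),\ldots,v_nf(\alpha_{i_n}))\mid f\in\mathcal{V}\}.$$ A generalized Reed-Solomon (GRS) code is a code $\mathcal{C}_{\mathcal{V}_k}(\boldsymbol{\alpha}',\boldsymbol{v}')$ with $\mathcal{V}_k=\{f\in\mathbb{F}_q[x]\mid\deg f\le k-1\}$, for some such $\boldsymbol{\alpha}',\boldsymbol{v}'$; a code is non-GRS if it is not a GRS code. A linear code $\mathcal{C}\subseteq\mathbb{F}_q^n$ of dimension $k$ and minimum Hamming distance $d$ is MDS if $d=n-k+1$, and self-orthogonal if $\mathcal{C}\subseteq\mathcal{C}^\perp$ with respect to the Euclidean inner product. *)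

(* Defs.v *)
From HB Require Import structures.
From mathcomp Require Import all_boot all_order all_algebra.
From mathcomp Require Import boolp classical_sets.

Set Implicit Arguments.
Unset Strict Implicit.
Unset Printing Implicit Defensive.

Import GRing.Theory.
Local Open Scope classical_set_scope.
Local Open Scope ring_scope.

Section Codes.
Variable F : finFieldType.

(* The bound deg f <= k - 1 is [size f <= k], which also covers f = 0. *)
Definition polys_lt (k : nat) : set {poly F} :=
  [set f : {poly F} | (size f <= k)%N].

(* Only the values a 0, ..., a (k - 1) matter as soon as h <= k - 1. *)
Definition twisted_poly (k t h : nat) (eta : F) (a : nat -> F) : {poly F} :=
  \sum_(i < k) a i *: 'X^i + (eta * a h) *: 'X^(k - 1 + t).

Definition twisted_polys (k t h : nat) (eta : F) : set {poly F} :=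
  [set twisted_poly k t h eta a | a in [set: nat -> F]].

Section Length.
Variable n : nat.
Implicit Types (V : set {poly F}) (alpha v x y : 'rV[F]_n) (C : set 'rV[F]_n).

Definition eval_points alpha : Prop := injective (alpha 0).

Definition multipliers v : Prop := forall j, v 0 j != 0.

Definition eval_code V alpha v : set 'rV[F]_n :=
  [set \row_j (v 0 j * f.[alpha 0 j]) | f in V].

Definition is_GRS C : Prop :=
  exists (k : nat) (alpha v : 'rV[F]_n),
    [/\ eval_points alpha, multipliers v &
        C = eval_code (polys_lt k) alpha v].

Definition dual_code C : set 'rV[F]_n :=
  [set y | forall x, C x -> \sum_(j < n) x 0 j * y 0 j = 0].

Definition self_orthogonal C : Prop := C `<=` dual_code C.

Definition hamming_dist x y : nat := #|[pred j : 'I_n | x 0 j != y 0 j]|.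

Definition is_min_dist C (d : nat) : Prop :=
  (exists x y, [/\ C x, C y, x <> y & hamming_dist x y = d]) /\
  (forall x y, C x -> C y -> x <> y -> (d <= hamming_dist x y)%N).

(* C is the underlying set of a linear subspace D, whose dimension is at most
   n, so that the truncated subtraction is harmless. *)
Definition is_MDS C : Prop :=
  exists D : {vspace 'rV[F]_n},
    C = [set` D] /\ is_min_dist C (n - \dim D + 1).

End Length.

(* For #|F| = p ^ m and r dividing m, exactly one K satisfies this:
   the subfield F_{p^r}. *)
Definition subfield_of_card (K : {set F}) (N : nat) : Prop :=
  divring_closed K /\ #|K| = N.

End Codes.

(* Main.v *)
(* Let Q = p ^ r, phi x = x ^ Q, N = k - 1 + t, and call a_0 + ... + a_(k-1) X^(k-1)
   + eta a_h X^N the twist of the polynomial of the a_i.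

   MDS: if a twisted polynomial f vanishes at k points of K = F_Q, so does f^phi.
   If a_h <> 0, scale f so that a_h = 1; as phi eta <> eta, eliminating X^N between
   f and f^phi leaves a polynomial of degree < k with k roots whose coefficient of
   index h is still 1, which is absurd. So a_h = 0, deg f < k and f = 0.

   Self-orthogonality: sum_(x in K^* ) x ^ e = 0 unless Q - 1 divides e, and the
   numerical hypotheses keep all exponents occurring in products of two twisted
   polynomials away from multiples of Q - 1. In situation (B), v_j ^ 2 = alpha_j
   shifts these exponents by one.

   Non-GRS: the componentwise products of the words of a GRS code of dimension k
   span a space of dimension at most 2k - 1. With f_i the twist of X^i, the
   products f_i f_j contain polynomials of every valuation 0, ..., 2k - 2, and some
   combination of them is a nonzero multiple of a monomial X^d with
   2k - 1 <= d < n, so here the span has dimension at least 2k. *)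
Require Import Defs.
From HB Require Import structures.
From mathcomp Require Import all_boot all_order all_algebra all_field.
From mathcomp Require Import zify ring.
From mathcomp Require Import boolp classical_sets.

Set Implicit Arguments.
Unset Strict Implicit.
Unset Printing Implicit Defensive.

Import GRing.Theory.
Local Open Scope ring_scope.

(** * Twisted polynomials and their roots fixed by an endomorphism *)

Definition twist (F : fieldType) (N h : nat) (eta : F) (p : {poly F}) : {poly F} :=
  p + (eta * p`_h) *: 'X^N.

Lemma twistD (F : fieldType) N h (eta : F) p q :
  twist N h eta (p + q) = twist N h eta p + twist N h eta q.
Proof. by rewrite /twist coefD mulrDr scalerDl addrACA. Qed.

Lemma twistZ (F : fieldType) N h (eta a : F) p :
  twist N h eta (a *: p) = a *: twist N h eta p.
Proof. by rewrite /twist coefZ scalerDr scalerA mulrCA. Qed.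

Lemma twistXn (F : fieldType) N h (eta : F) i :
  twist N h eta 'X^i = 'X^i + (if i == h then eta else 0) *: 'X^N.
Proof.
rewrite /twist coefXn eq_sym; case: eqP => _; by rewrite ?mulr1 ?mulr0.
Qed.

Lemma twist_roots (F : fieldType) (phi : {rmorphism F -> F}) N h k (eta : F)
    (p : {poly F}) (s : seq F) :
  phi eta != eta -> (size p <= k)%N -> uniq s -> (k <= size s)%N ->
  {in s, forall x, phi x = x} -> all (root (twist N h eta p)) s -> p = 0.
Proof.
move=> ne sp us sk sphi rs.
have noroot (q : {poly F}) : (size q <= k)%N -> all (root q) s -> q = 0.
  move=> sq rq; apply/eqP/negPn/negP => nq.
  by have := max_poly_roots nq rq us; rewrite ltnNge (leq_trans sq sk).
have [ph0|nph] := eqVneq p`_h 0.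
  by move: rs; rewrite /twist ph0 mulr0 scale0r addr0; apply: noroot.
wlog p1 : p sp rs nph / p`_h = 1.
  move=> /(_ ((p`_h)^-1 *: p)) H.
  have p1 : ((p`_h)^-1 *: p)`_h = 1 by rewrite coefZ mulVf.
  have /eqP : (p`_h)^-1 *: p = 0.
    apply: H => //.
    - exact: leq_trans (size_scale_leq _ _) sp.
    - rewrite twistZ; apply/allP => x xs.
      by rewrite rootE hornerZ (eqP (allP rs x xs)) mulr0.
    - by rewrite p1 oner_eq0.
  by rewrite scaler_eq0 invr_eq0 (negPf nph) => /eqP.
(* [c] solves eta = c (eta - phi eta), so X^N cancels in [gE]. The subtracted difference has
   coefficient 1 - phi 1 = 0 at h, so [g] keeps the coefficient 1 there. *)
pose c := eta / (eta - phi eta).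
pose g := p - c *: (p - map_poly phi p).
have ned : eta - phi eta != 0 by rewrite subr_eq0 eq_sym.
have gE : g = twist N h eta p
            - c *: (twist N h eta p - map_poly phi (twist N h eta p)).
  have -> : twist N h eta p - map_poly phi (twist N h eta p) =
    (p - map_poly phi p) + (eta - phi eta) *: 'X^N.
    rewrite /twist p1 !mulr1 rmorphD /= map_polyZ map_polyXn scalerBl.
    by rewrite opprD addrACA.
  rewrite scalerDr scalerA divfK // /g /twist p1 mulr1.
  by rewrite opprD addrACA subrr addr0.
have g0 : g = 0.
  apply: noroot.
    rewrite (leq_trans (size_polyD _ _)) // size_polyN geq_max sp.
    rewrite (leq_trans (size_scale_leq _ _)) //.
    rewrite (leq_trans (size_polyD _ _)) // size_polyN geq_max sp.
    by rewrite size_map_poly.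
  apply/allP => x xs.
  have fx : (twist N h eta p).[x] = 0 by apply/eqP/(allP rs).
  have fx' : (map_poly phi (twist N h eta p)).[x] = 0.
    by rewrite -{1}(sphi x xs) horner_map fx rmorph0.
  rewrite gE rootE hornerD hornerN hornerZ [X in _ - _ * X]hornerD hornerN.
  by rewrite fx fx' subrr mulr0 subrr.
have : g`_h = 1 by rewrite coefB coefZ coefB coef_map /= p1 rmorph1 subrr mulr0 subr0.
by rewrite g0 coef0 => /esym /eqP; rewrite oner_eq0.
Qed.

Lemma frobenius_power (F : fieldType) (p r : nat) :
  p \in [pchar F] -> exists phi : {rmorphism F -> F}, forall x, phi x = x ^+ (p ^ r).
Proof.
move=> pF; elim: r => [|r [phi IH]].
  by exists (@idfun F) => x; rewrite expr1.
exists (pFrobenius_aut pF \o phi) => x /=.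
by rewrite IH pFrobenius_autE expnSr exprM.
Qed.

(** * Products and power sums over a finite subfield *)

Section Subfield.
Variables (F : finFieldType) (K : {set F}) (Q : nat).
Hypothesis hK : subfield_of_card K Q.

Let K1 : 1 \in K. Proof. by have [[]] := hK. Qed.
Let KB : {in K &, forall x y, x - y \in K}. Proof. by have [[]] := hK. Qed.
Let KV : {in K &, forall x y, x / y \in K}. Proof. by have [[]] := hK. Qed.

Lemma subfield0 : 0 \in K.
Proof. by rewrite -(subrr 1) KB. Qed.

Lemma subfieldM : {in K &, forall x y, x * y \in K}.
Proof.
move=> x y xK yK; have := KV xK (KV K1 yK).
by rewrite div1r invrK.
Qed.

Lemma card_subfield : #|K| = Q.
Proof. by have [] := hK. Qed.

Lemma card_subfield_gt1 : (1 < Q)%N.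
Proof.
rewrite -card_subfield (cardD1 0) subfield0 (cardD1 1) !inE oner_eq0.
by rewrite K1.
Qed.

Lemma card_subfieldD1 : #|K :\ 0| = Q.-1.
Proof. by rewrite -card_subfield (cardsD1 0 K) subfield0. Qed.

(** Multiplication by y permutes the nonzero elements of K. The operation is abstract because both
    products and sums get reindexed. *)
Lemma mulf_reindex (T : Type) (idx : T) (op : Monoid.com_law idx) (y : F)
    (f : F -> T) : y \in K :\ 0 ->
  \big[op/idx]_(x in K :\ 0) f x = \big[op/idx]_(x in K :\ 0) f (y * x).
Proof.
rewrite !inE => /andP[y0 yK].
rewrite (reindex_onto (fun x => y * x) (fun x => y^-1 * x)) /=; last first.
  by move=> x _; rewrite mulrA divff // mul1r.
apply: eq_bigl => x; rewrite !inE mulrA mulVf // mul1r eqxx andbT.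
rewrite mulf_eq0 (negPf y0) /=; case: eqP => //= _.
apply/idP/idP => [yxK|]; last exact: subfieldM.
by have := KV yxK yK; rewrite mulrC mulKf.
Qed.

Lemma subfield_prod_neq0 : \prod_(x in K :\ 0) x != 0 :> F.
Proof. by apply/prodf_neq0 => x; rewrite !inE => /andP[]. Qed.

(** Reindexing the product P of all nonzero elements gives P = x^(Q-1) P, and P can be cancelled. *)
Lemma subfield_exp1 x : x \in K :\ 0 -> x ^+ Q.-1 = 1.
Proof.
move=> xK; have := mulf_reindex *%R id xK; rewrite /= big_split /=.
rewrite prodr_const card_subfieldD1 => /eqP.
rewrite -{1}[X in X == _]mul1r (inj_eq (mulIf subfield_prod_neq0)).
by move/eqP.
Qed.

Lemma subfield_exp x : x \in K -> x ^+ Q = x.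
Proof.
move=> xK; have Q0 : (0 < Q)%N by have := card_subfield_gt1; case: Q.
have [->|x0] := eqVneq x 0; first by rewrite expr0n; case: Q Q0.
by rewrite -(prednK Q0) exprS subfield_exp1 ?mulr1 // !inE x0.
Qed.

(** X^Q - X already has Q roots in K, so there is no room for another. This turns eta outside K into
    phi eta <> eta. *)
Lemma subfield_expP x : (x ^+ Q == x) = (x \in K).
Proof.
apply/eqP/idP => [xQ|/subfield_exp//]; apply/negPn/negP => xK.
have Q1 := card_subfield_gt1.
pose P : {poly F} := 'X^Q - 'X.
have sP : size P = Q.+1 by rewrite size_polyDl size_polyXn // size_polyN size_polyX.
have P0 : P != 0 by rewrite -size_poly_eq0 sP.
have : all (root P) (x :: enum K).
  apply/allP => y; rewrite inE mem_enum => /predU1P[->|/subfield_exp yQ];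
    by rewrite rootE /P !hornerE ?xQ ?yQ subrr.
move/(max_poly_roots P0); rewrite /= mem_enum xK enum_uniq sP => /(_ isT).
by rewrite -cardE card_subfield ltnn.
Qed.

(** For a nonzero y in K with y^e <> 1, reindexing by y gives S = y^e S for the sum S, hence S =
    0. *)
Lemma subfield_sum_expn (e : nat) : ~~ (Q.-1 %| e)%N ->
  \sum_(x in K :\ 0) x ^+ e = 0.
Proof.
move=> ne.
have [y yK ye] : exists2 y, y \in K :\ 0 & y ^+ e != 1.
  (* Otherwise X^e' - 1, with e' the nonzero remainder of e modulo Q - 1, would have Q - 1 roots,
     more than its degree. *)
  apply/exists_inP; apply: contraT; rewrite negb_exists_in => /forall_inP H.
  have Q1 := card_subfield_gt1.
  pose e' := (e %% Q.-1)%N; have e'0 : (0 < e')%N by rewrite lt0n.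
  pose P : {poly F} := 'X^e' - 1.
  have sP : size P = e'.+1 by rewrite size_XnsubC.
  have P0 : P != 0 by rewrite -size_poly_eq0 sP.
  have : all (root P) (enum (K :\ 0)).
    apply/allP => x; rewrite mem_enum => xK; move/negPn: (H x xK) => /eqP.
    rewrite {1}(divn_eq e Q.-1) exprD mulnC exprM subfield_exp1 // expr1n mul1r.
    by rewrite rootE /P !hornerE => ->; rewrite subrr.
  move/(max_poly_roots P0); rewrite enum_uniq sP => /(_ isT).
  rewrite -cardE card_subfieldD1 ltnS leqNgt ltn_mod.
  by case: Q Q1 => [|[]].
have := mulf_reindex +%R (fun x => x ^+ e) yK.
under [RHS]eq_bigr => x _ do rewrite exprMn.
rewrite -big_distrr /= => /eqP; rewrite -subr_eq0 -{1}[X in X - _]mul1r -mulrBl.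
by rewrite mulf_eq0 subr_eq0 eq_sym (negPf ye) => /eqP.
Qed.

(** Inversion permutes the factors, so the product squares to 1; and -1 = 1 in characteristic 2. *)
Lemma subfield_prod_eq1 : 2 \in [pchar F] -> \prod_(x in K :\ 0) x = 1 :> F.
Proof.
move=> F2; set P := \prod_(x in _) x.
have : P * P = 1.
  rewrite {1}/P (reindex_onto (fun x => x^-1) (fun x => x^-1)) /=; last first.
    by move=> x _; rewrite invrK.
  rewrite (eq_bigl (mem (K :\ 0))) => [|x]; last first.
    rewrite !inE invrK eqxx andbT invr_eq0; case: eqP => //= _.
    by apply/idP/idP => /(KV K1); rewrite div1r ?invrK.
  rewrite -big_split /= big1 // => x; rewrite !inE => /andP[x0 _].
  by rewrite mulVf.
move/eqP; rewrite -expr2 sqrf_eq1 => /orP[]/eqP-> //.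
by rewrite oppr_pchar2.
Qed.

End Subfield.

(** * MDS codes through the zeros of their words *)

Definition zeros (F : finFieldType) n (x : 'rV[F]_n) : {set 'I_n} :=
  [set j | x 0 j == 0].

Lemma hamming_dist_zeros (F : finFieldType) n (x y : 'rV[F]_n) :
  hamming_dist x y = (n - #|zeros (x - y)|)%N.
Proof.
rewrite -[X in (X - _)%N]card_ord -(cardC [in zeros (x - y)]) addKn.
by apply: eq_card => j; rewrite !inE !mxE subr_eq0.
Qed.

Lemma generator_MDS (F : finFieldType) k n (G : 'M[F]_(k, n)) (C : set 'rV[F]_n) :
  (0 < k <= n)%N -> (forall x, C x <-> exists u : 'rV_k, x = u *m G) ->
  (forall x, C x -> x != 0 -> (#|zeros x| < k)%N) ->
  row_free G -> is_MDS C.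
Proof.
move=> /andP[k0 kn] CE zC fG.
pose D : {vspace 'rV[F]_n} := limg (linfun (mulmxr G)).
have dD : \dim D = k.
  rewrite limg_dim_eq ?dimvf; first by rewrite dim_matrix mul1r.
  apply/eqP; rewrite capfv; apply/lker0P => u w; rewrite !lfunE /=.
  by apply/row_free_inj.
have CB x y : C x -> C y -> C (x - y).
  move=> /CE[u ->] /CE[w ->]; apply/CE; exists (u - w).
  by rewrite mulmxBl.
exists D; split.
  apply/predeqP => x; rewrite CE /=; split => [[u ->]|/memv_imgP[u _ ->]].
    by have := memv_img (linfun (mulmxr G)) (memvf u); rewrite lfunE.
  by exists u; rewrite lfunE.
rewrite dD; split; last first.
  move=> x y Cx Cy /eqP; rewrite -subr_eq0 => xy.
  by have := zC _ (CB _ _ Cx Cy) xy; rewrite hamming_dist_zeros; lia.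
(* Singleton bound: k - 1 columns of [G] have rank below k, so some nonzero u gives a word vanishing
   at the first k - 1 positions. *)
have kn' : (k.-1 <= n)%N by lia.
have : kermx (colsub (widen_ord kn') G) != 0.
  rewrite kermx_eq0 /row_free neq_ltn; apply/orP; left.
  by rewrite (leq_ltn_trans (rank_leq_col _)) // prednK.
move=> /rowV0Pn[u /sub_kermxP uG u0].
have uG0 : u *m G != 0.
  by apply: contra u0 => /eqP uG0; apply/eqP/(row_free_inj fG); rewrite /= uG0 mul0mx.
have Cu : C (u *m G) by apply/CE; exists u.
have C0 : C 0 by apply/CE; exists 0; rewrite mul0mx.
exists (u *m G), 0; split=> //; first exact/eqP.
have := zC _ Cu uG0; rewrite hamming_dist_zeros subr0.
suff : (k.-1 <= #|zeros (u *m G)|)%N by lia.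
have winj : injective (widen_ord kn') by move=> a b [ab]; apply: val_inj.
have <- : #|[set widen_ord kn' j | j : 'I_k.-1]%SET| = k.-1.
  by rewrite card_imset // card_ord.
apply: subset_leq_card; apply/fintype.subsetP => _ /imsetP[j _ ->]; rewrite inE.
move/rowP/(_ j): uG; rewrite !mxE => uG; apply/eqP; rewrite -[RHS]uG.
by apply: eq_bigr => i _; rewrite mxE.
Qed.

(** * The twisted code: generator matrix, distance, self-orthogonality *)

Section TwistedCode.
Variables (F : finFieldType) (k t h n : nat) (eta : F) (alpha v : 'rV[F]_n).
Let N := (k - 1 + t)%N.
Let f := twist N h eta.
Let C := eval_code (twisted_polys k t h eta) alpha v.

Definition twisted_gen : 'M[F]_(k, n) :=
  \matrix_(i, j) (v 0 j * (f 'X^i).[alpha 0 j]).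

Lemma mul_twisted_gen (u : 'rV_k) :
  u *m twisted_gen = \row_j (v 0 j * (f (rVpoly u)).[alpha 0 j]).
Proof.
apply/rowP => j; rewrite !mxE.
have -> : f (rVpoly u) = \sum_i u 0 i *: f 'X^i.
  rewrite /rVpoly poly_def.
  rewrite (big_morph f (id1 := 0) (op1 := +%R)); last 2 first.
  - exact: twistD.
  - by rewrite /f /twist coef0 mulr0 scale0r addr0.
  by apply: eq_bigr => i _; rewrite /f twistZ valK.
rewrite horner_sum mulr_sumr; apply: eq_bigr => i _.
by rewrite !mxE hornerZ mulrCA.
Qed.

Lemma twisted_codeE x : (h < k)%N ->
  C x <-> exists u : 'rV_k, x = u *m twisted_gen.
Proof.
move=> hk; have tE a : twisted_poly k t h eta a = f (\poly_(i < k) a i).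
  by rewrite /twisted_poly /f /twist coef_poly hk poly_def.
split=> [[_ [a _ <-] <-]|[u ->]].
  exists (\row_(i < k) a i); rewrite mul_twisted_gen tE.
  suff -> : \poly_(i < k) a i = rVpoly (\row_(i < k) a i) by [].
  apply/polyP => i; rewrite !coef_poly; case: ifP => // ik.
  by rewrite insubT mxE.
exists (f (rVpoly u)); last by rewrite mul_twisted_gen.
exists (fun i => (rVpoly u)`_i) => //; rewrite tE; congr f; apply/polyP => i.
by rewrite coef_poly; case: ltnP => // ki; rewrite nth_default ?(leq_trans (size_poly _ _)).
Qed.

Section Distance.
Variable phi : {rmorphism F -> F}.
Hypotheses (phi_eta : phi eta != eta) (phi_alpha : forall j, phi (alpha 0 j) = alpha 0 j).
Hypotheses (inj_alpha : eval_points alpha) (v_neq0 : multipliers v).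

Lemma twisted_gen_zeros (u : 'rV_k) :
  u != 0 -> (#|zeros (u *m twisted_gen)| < k)%N.
Proof.
apply: contraNT; rewrite -leqNgt => kz.
suff : rVpoly u = 0 by move=> u0; rewrite -[u]rVpolyK u0 linear0.
apply: (twist_roots (N := N) (h := h) (k := k)
   (s := [seq alpha 0 j | j in zeros (u *m twisted_gen)]) phi_eta).
- exact: size_poly.
- by rewrite (map_inj_uniq inj_alpha) enum_uniq.
- by rewrite size_map -cardE.
- by move=> _ /mapP[j _ ->].
- apply/allP => _ /mapP[j jz ->]; move: jz.
  by rewrite mem_enum inE mul_twisted_gen mxE mulf_eq0 (negPf (v_neq0 j)).
Qed.

Lemma twisted_code_zeros x : (h < k)%N -> C x -> x != 0 -> (#|zeros x| < k)%N.
Proof.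
move=> hk /(twisted_codeE _ hk)[u ->] u0; apply: twisted_gen_zeros.
by apply: contra u0 => /eqP ->; rewrite mul0mx.
Qed.

Lemma twisted_MDS : (h < k <= n)%N -> is_MDS C.
Proof.
move=> /andP[hk kn]; apply: (@generator_MDS _ k n twisted_gen).
- by rewrite kn (leq_ltn_trans _ hk).
- by move=> x; apply: twisted_codeE.
- by move=> x; apply: twisted_code_zeros.
(* A nonzero kernel vector would give the zero word, whose n >= k zeros are too many. *)
apply: inj_row_free => u uG0; apply/eqP/negPn/negP => /twisted_gen_zeros.
rewrite uG0 (_ : zeros 0 = [set: 'I_n]) ?cardsT ?card_ord; first by lia.
by apply/setP => j; rewrite !inE mxE eqxx.
Qed.

End Distance.

(** It suffices to test generators: the product of the twists of X^a and X^b involves only the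
    exponents a + b, N + a, N + b and 2N, the first three being at most N + k - 1. *)
Lemma twisted_self_orthogonal : (h < k)%N ->
  (forall e, (e <= N + (k - 1))%N -> \sum_j v 0 j ^+ 2 * alpha 0 j ^+ e = 0) ->
  \sum_j v 0 j ^+ 2 * alpha 0 j ^+ (2 * N) = 0 ->
  self_orthogonal C.
Proof.
move=> hk Z Z2 x Cx y Cy.
move: Cx Cy => /(twisted_codeE _ hk)[u ->] /(twisted_codeE _ hk)[w ->].
have GG : twisted_gen *m twisted_gen^T = 0.
  apply/matrixP => a b; rewrite !mxE.
  pose c (i : nat) := if i == h then eta else 0.
  have E j : twisted_gen a j * (twisted_gen^T) j b =
    v 0 j ^+ 2 * alpha 0 j ^+ (a + b)
    + c b * (v 0 j ^+ 2 * alpha 0 j ^+ (N + a))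
    + c a * (v 0 j ^+ 2 * alpha 0 j ^+ (N + b))
    + c a * c b * (v 0 j ^+ 2 * alpha 0 j ^+ (2 * N)).
    rewrite !mxE /f !twistXn -/(c a) -/(c b) !(hornerD, hornerZ, hornerXn).
    by rewrite mul2n -addnn !exprD; ring.
  under eq_bigr do rewrite E.
  have := ltn_ord a; have := ltn_ord b => bk ak.
  rewrite !big_split /= -!mulr_sumr Z2 !Z ?mulr0 ?addr0 // /N; lia.
have : (w *m twisted_gen) *m (u *m twisted_gen)^T = 0.
  by rewrite trmx_mul mulmxA -(mulmxA w) GG mulmx0 mul0mx.
move/matrixP/(_ 0 0); rewrite !mxE => H; rewrite -[RHS]H.
by apply: eq_bigr => j _; rewrite [(u *m _)^T _ _]mxE.
Qed.

End TwistedCode.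

(** * Componentwise products of words, and GRS codes *)

Definition evalv (F : fieldType) n (alpha w : 'rV[F]_n) (P : {poly F}) : 'rV_n :=
  \row_j (w 0 j * P.[alpha 0 j]).

Lemma evalvD (F : fieldType) n (alpha w : 'rV[F]_n) P Q :
  evalv alpha w (P + Q) = evalv alpha w P + evalv alpha w Q.
Proof. by apply/rowP => j; rewrite !mxE hornerD mulrDr. Qed.

Lemma evalvZ (F : fieldType) n (alpha w : 'rV[F]_n) a P :
  evalv alpha w (a *: P) = a *: evalv alpha w P.
Proof. by apply/rowP => j; rewrite !mxE hornerZ mulrCA. Qed.

(** A product of two polynomials of degree below k is a combination of 1, ..., X^(2k-2), here
    evaluated with weights v_j^2. *)
Lemma GRS_square (F : finFieldType) n k (alpha v : 'rV[F]_n) :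
  exists U : 'M[F]_((k + k).-1, n), forall x y,
    eval_code (polys_lt k) alpha v x -> eval_code (polys_lt k) alpha v y ->
    (\row_j (x 0 j * y 0 j)%R <= U)%MS.
Proof.
exists (\matrix_(i, j) (v 0 j ^+ 2 * alpha 0 j ^+ i)).
move=> _ _ [p sp <-] [q sq <-]; apply/submxP.
exists (poly_rV (p * q)); apply/rowP => j; rewrite !mxE.
rewrite mulrACA -expr2 -hornerM (@horner_coef_wide _ (k + k).-1); last first.
  by rewrite (leq_trans (size_polyMleq _ _)) // -!subn1 leq_sub2r // leq_add.
by rewrite mulr_sumr; apply: eq_bigr => i _; rewrite !mxE mulrCA.
Qed.

(** The product of the X - alpha_j over the first k points has degree k < k' and does not vanish at
    the next point. This bounds k' when nonzero words have fewer than k zeros. *)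
Lemma GRS_zeros (F : finFieldType) n k k' (alpha v : 'rV[F]_n) :
  eval_points alpha -> multipliers v -> (k < n)%N -> (k < k')%N ->
  exists x, [/\ eval_code (polys_lt k') alpha v x, x != 0 & (k <= #|zeros x|)%N].
Proof.
move=> ia v0 kn kk'.
pose w (i : 'I_k) : 'I_n := widen_ord (ltnW kn) i.
pose s := [seq alpha 0 (w i) | i : 'I_k].
pose p := \prod_(x <- s) ('X - x%:P).
have rp x : root p x = (x \in s) by rewrite root_prod_XsubC.
exists (\row_j (v 0 j * p.[alpha 0 j])); split.
- exists p => //; rewrite /polys_lt /= size_prod_XsubC.
  by rewrite size_map size_enum_ord.
- apply/eqP => /rowP/(_ (Ordinal kn))/eqP; rewrite !mxE mulf_eq0 (negPf (v0 _)) /=.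
  rewrite -/(root p _) rp => /mapP[i _ E]; have /= ki := congr1 val (ia _ _ E).
  by have := ltn_ord i; rewrite -ki ltnn.
have winj : injective w by move=> a b [ab]; apply: val_inj.
have <- : #|[set w j | j : 'I_k]%SET| = k by rewrite card_imset // card_ord.
apply: subset_leq_card; apply/fintype.subsetP => _ /imsetP[j _ ->]; rewrite inE mxE.
rewrite mulf_eq0; apply/orP; right; rewrite -/(root p _) rp.
by apply/mapP; exists j; rewrite ?mem_enum.
Qed.

(** A combination vanishing at all n points has size at most n, so it is the zero polynomial. The
    coefficients at the positions [d] form a triangular matrix with nonzero diagonal, which forces
    all scalars to be 0. *)
Lemma valuation_row_free (F : fieldType) m n (alpha w : 'rV[F]_n)
    (P : 'I_m -> {poly F}) (d : 'I_m -> nat) :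
  injective (alpha 0) -> (forall j, w 0 j != 0) ->
  (forall i, size (P i) <= n)%N ->
  {homo d : i j / (i < j)%N} ->
  (forall i, (P i)`_(d i) != 0) ->
  (forall i l, (l < d i)%N -> (P i)`_l = 0) ->
  row_free (\matrix_i evalv alpha w (P i)).
Proof.
move=> ia w0 sP dP Pd Pl; apply: inj_row_free => u uM.
pose R := \sum_i u 0 i *: P i.
have R0 : R = 0.
  apply/eqP/negPn/negP => nR.
  have : all (root R) [seq alpha 0 j | j in 'I_n].
    apply/allP => _ /mapP[j _ ->].
    move/rowP/(_ j): uM; rewrite !mxE => uMj.
    have : w 0 j * R.[alpha 0 j] = 0.
      rewrite -[RHS]uMj horner_sum mulr_sumr; apply: eq_bigr => i _.
      by rewrite !mxE hornerZ mulrCA.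
    by move/eqP; rewrite mulf_eq0 (negPf (w0 j)).
  move/(max_poly_roots nR); rewrite (map_inj_uniq ia) enum_uniq => /(_ isT).
  rewrite size_map -cardE card_ord ltnNge => /negP[].
  rewrite (leq_trans (size_sum _ _ _)) //; apply/bigmax_leqP => i _.
  exact: leq_trans (size_scale_leq _ _) (sP i).
pose T : 'M[F]_m := \matrix_(i, j) (P i)`_(d j).
have Tu : T \in unitmx.
  rewrite unitmxE -det_tr det_trig; last first.
    by apply/is_trig_mxP => i j ij; rewrite !mxE Pl // dP.
  by rewrite unitfE; apply/prodf_neq0 => i _; rewrite !mxE.
have uT : u *m T = 0.
  apply/rowP => j; rewrite !mxE.
  have := congr1 (fun p : {poly F} => p`_(d j)) R0; rewrite coef0 coef_sum => H.
  by rewrite -[RHS]H; apply: eq_bigr => i _; rewrite mxE coefZ.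
by rewrite -(mulmxK Tu u) uT mul0mx.
Qed.

(** * The twisted code is not GRS *)

Section NonGRS.
Variables (F : finFieldType) (k t h n : nat) (eta : F) (alpha v : 'rV[F]_n).
Let N := (k - 1 + t)%N.
Let f i := twist N h eta 'X^i.
Let C := eval_code (twisted_polys k t h eta) alpha v.
Hypotheses (inj_alpha : eval_points alpha) (v_neq0 : multipliers v).
Hypotheses (k3 : (3 <= k)%N) (t1 : (1 <= t)%N) (htk : (t + h <= k - 1)%N).
Hypothesis eta_neq0 : eta != 0.
Hypothesis kn : (k - 1 + N < n)%N.
Hypothesis t1n : t = 1%N -> (2 * k < n)%N.
Hypothesis red2N : exists2 e, (0 < e < n)%N &
  forall j, alpha 0 j ^+ (2 * N) = alpha 0 j ^+ e.
Hypothesis C_zeros : forall x, C x -> x != 0 -> (#|zeros x| < k)%N.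

Let w : 'rV[F]_n := \row_j v 0 j ^+ 2.
Let c i := if i == h then eta else 0.

Let hk : (h < k)%N. Proof. lia. Qed.

Lemma twist_mulXn a b : f a * f b =
  'X^(a + b) + c b *: 'X^(a + N) + c a *: 'X^(b + N) + (c a * c b) *: 'X^(2 * N).
Proof.
rewrite /f !twistXn -/(c a) -/(c b) -!mul_polyC polyCM mul2n -addnn !exprD.
ring.
Qed.

(** [kn] makes every exponent of a product except 2N smaller than n, and [red2N] lowers 2N to a
    positive e, which leaves the constant term intact. [t1n] serves the case d = 2k. *)
Lemma twisted_square_rank r (U : 'M[F]_(r, n)) :
  (forall x y, C x -> C y -> (\row_j (x 0 j * y 0 j)%R <= U)%MS) -> (2 * k <= r)%N.
Proof.
move=> CU.
pose Sq P := (evalv alpha w P <= U)%MS.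
have SqD P Q : Sq P -> Sq Q -> Sq (P + Q).
  by rewrite /Sq evalvD; apply: addmx_sub.
have SqZ a P : Sq P -> Sq (a *: P).
  by rewrite /Sq evalvZ; apply: scalemx_sub.
have SqB P Q : Sq P -> Sq Q -> Sq (P - Q).
  by move=> sP sQ; rewrite -scaleN1r; apply/SqD/SqZ.
have Sqf a b : (a < k)%N -> (b < k)%N -> Sq (f a * f b).
  move=> ak bk.
  have Cf (i : 'I_k) : C (row i (twisted_gen k t h eta alpha v)).
    by apply/(twisted_codeE _ _ _ _ _ hk); exists (delta_mx 0 i); rewrite rowE.
  have := CU _ _ (Cf (Ordinal ak)) (Cf (Ordinal bk)); congr (_ <= _)%MS.
  by apply/rowP => j; rewrite !mxE hornerM mulrACA -expr2.
have [d /andP[d1 d2] Sd] : exists2 d, (2 * k - 1 <= d < n)%N & Sq 'X^d.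
  (* Cancelling the untwisted part X^(k-1+h) of f_(k-1) f_h needs a factorization
     X^a X^b with a, b <> h, which does not exist when h = k - 2. *)
  have [hk2|hk2] := leqP h.+3 k.
    exists (k - 1 + N)%N; first by apply/andP; split; rewrite ?/N //; lia.
    rewrite -['X^_]scale1r -(mulVf eta_neq0) -scalerA; apply/SqZ.
    suff -> : eta *: 'X^(k - 1 + N) = f (k - 1) * f h - f (k - 2) * f h.+1.
      by apply: SqB; apply: Sqf; lia.
    rewrite !twist_mulXn /c eqxx !ifN; try (apply/eqP; lia).
    rewrite !(mul0r, mulr0, scale0r, addr0) (_ : k - 2 + h.+1 = k - 1 + h)%N; last lia.
    by rewrite addrC addKr.
  have te : t = 1%N by lia.
  have he : h = (k - 2)%N by lia.
  have Ne : N = k by rewrite /N; lia.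
  (* With h = k - 2 and N = k, f_h^2 = X^(2h) + 2 eta X^(h+k) + eta^2 X^(2k); the two lower
     monomials are the untwisted products f_(k-1) f_(k-3) and f_(k-1)^2. *)
  exists (2 * k)%N; first by have := t1n te; lia.
  have e2 : eta ^+ 2 != 0 by rewrite expf_neq0.
  rewrite -['X^_]scale1r -(mulVf e2) -scalerA; apply/SqZ.
  suff -> : eta ^+ 2 *: 'X^(2 * k) = f h * f h - f (k - 1) * f (k - 3)
              - (2 * eta) *: (f (k - 1) * f (k - 1)).
    by apply/SqB/SqZ; [apply: SqB|]; apply: Sqf; lia.
  rewrite !twist_mulXn /c eqxx !ifN; try (apply/eqP; lia).
  rewrite !(mul0r, mulr0, scale0r, addr0) Ne.
  rewrite (_ : k - 1 + (k - 3) = h + h)%N; last lia.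
  rewrite (_ : k - 1 + (k - 1) = h + k)%N; last lia.
  rewrite -!mul_polyC expr2 !polyCM rmorph_nat.
  ring.
(* The first 2k - 1 indices get valuation i, the last one gets d; the sequence increases since d >=
   2k - 1. *)
have H (i : 'I_(2 * k)) : exists P : {poly F},
    [/\ Sq P, (size P <= n)%N, P`_(if i.+1 == (2 * k)%N then d else i) != 0 &
      forall l, (l < if i.+1 == (2 * k)%N then d else i)%N -> P`_l = 0].
  case: eqP => [_|/eqP ik].
    exists 'X^d; split=> //; first by rewrite size_polyXn.
      by rewrite coefXn eqxx oner_eq0.
    by move=> l ld; rewrite coefXn ltn_eqF.
  have i2k : (i.+1 < 2 * k)%N by rewrite ltn_neqAle ik ltn_ord.
  have szX e a : (e < n)%N -> (size (a *: 'X^e : {poly F}) <= n)%N.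
    by move=> en; rewrite (leq_trans (size_scale_leq _ _)) // size_polyXn.
  (* Only f_0 f_0 with h = 0 may have degree 2N >= n; its top monomial is replaced
     by one with the same values at the evaluation points. *)
  have [i0|i0] := boolP (((i : nat) == 0%N) && (h == 0%N)).
    have [e /andP[e1 en] Ee] := red2N; case/andP: i0 => /eqP-> /eqP h0.
    have N0 : (0 < N)%N by rewrite /N; lia.
    exists (1 + (2 * eta) *: 'X^N + eta ^+ 2 *: 'X^e); split=> //.
    + have := Sqf 0%N 0%N; rewrite /Sq twist_mulXn /c h0 eqxx => /(_ _ _)S.
      suff -> : evalv alpha w (1 + (2 * eta) *: 'X^N + eta ^+ 2 *: 'X^e) =
        evalv alpha w ('X^(0 + 0) + eta *: 'X^(0 + N) + eta *: 'X^(0 + N)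
                       + (eta * eta) *: 'X^(2 * N)) by apply: S; lia.
      apply/rowP => j; rewrite !mxE !(hornerD, hornerZ, hornerXn, hornerC) Ee add0n.
      ring.
    + rewrite (leq_trans (size_polyD _ _)) // geq_max szX // andbT.
      rewrite (leq_trans (size_polyD _ _)) // geq_max szX ?andbT ?size_poly1 //; lia.
    + rewrite !coefD !coefZ !coefXn coef1 /= !ltn_eqF // !mulr0 !addr0.
      exact: oner_neq0.
  (* Split i = a + b with a = 0 or a = k - 1. As h <= k - 2, both factors are twisted only when i =
     h = 0, already treated. Since a, b < k <= N, the twist terms lie above X^i. *)
  pose a := if (i < k)%N then 0%N else (k - 1)%N.
  pose b := (i - a)%N.
  have ak : (a < k)%N by rewrite /a; case: ifP; lia.
  have bk : (b < k)%N by rewrite /b /a; case: ifP; lia.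
  have ab : (a + b)%N = i by rewrite /b /a; case: ifP; lia.
  have cc : c a * c b = 0.
    rewrite /c; case: eqP => [ah|]; last by rewrite mul0r.
    case: eqP => [bh|]; last by rewrite mulr0.
    by move: i0 ah ab; rewrite bh /a; case: ifP; lia.
  have kN : (k <= N)%N by rewrite /N; lia.
  have E : f a * f b = 'X^i + c b *: 'X^(a + N) + c a *: 'X^(b + N).
    by rewrite twist_mulXn cc scale0r addr0 ab.
  exists (f a * f b); split.
  + exact: Sqf.
  + rewrite E (leq_trans (size_polyD _ _)) // geq_max szX ?andbT; last lia.
    rewrite (leq_trans (size_polyD _ _)) // geq_max szX ?andbT ?size_polyXn //; lia.
  + rewrite E !coefD !coefZ !coefXn eqxx !ltn_eqF ?mulr0 ?addr0 ?oner_eq0 //; lia.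
  + move=> l li; rewrite E !coefD !coefZ !coefXn !ltn_eqF ?mulr0 ?addr0 //; lia.
have [P HP] := fin_all_exists H.
have : row_free (\matrix_i evalv alpha w (P i)).
  apply: (valuation_row_free (d := fun i => if i.+1 == (2 * k)%N then d else i)) => //.
  - by move=> j; rewrite mxE expf_neq0.
  - by move=> i; have [] := HP i.
  - move=> i j ij; have := ltn_ord j; case: eqP; case: eqP; lia.
  - by move=> i; have [] := HP i.
  - by move=> i; have [] := HP i.
rewrite /row_free => /eqP <-.
apply: leq_trans (rank_leq_row U); apply: mxrankS; apply/row_subP => i.
by rewrite rowK; have [] := HP i.
Qed.

(** The GRS parameter k' need not be k a priori. Counting zeros gives k' <= k, and the square then
    has rank at most 2k - 2 + 1, below 2k. *)
Lemma twisted_nonGRS : ~ is_GRS C.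
Proof.
move=> [k' [alpha' [v' [ia' v0' CE]]]].
have k'k : (k' <= k)%N.
  rewrite leqNgt; apply/negP => kk'.
  have kn' : (k < n)%N by move: kn; rewrite /N; lia.
  have [x []] := GRS_zeros ia' v0' kn' kk'.
  by rewrite -CE => Cx x0; rewrite leqNgt C_zeros.
have [U HU] := GRS_square k' alpha' v'.
have := twisted_square_rank (U := U); rewrite CE => /(_ HU); lia.
Qed.

End NonGRS.

(** * Power sums including 0, and the multipliers of situation (B) *)

Lemma subfield_sum_expn_char (F : finFieldType) (K : {set F}) (Q e : nat) :
  subfield_of_card K Q -> Q%:R = 0 :> F -> (e == 0%N) || ~~ (Q.-1 %| e)%N ->
  \sum_(x in K) x ^+ e = 0.
Proof.
move=> hK Q0 /orP[/eqP->|ne].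
  (* With 0^0 = 1 the sum is the cardinality Q, which is 0 in F. *)
  by under eq_bigr do rewrite expr0; rewrite sumr_const (card_subfield hK).
have e0 : e != 0%N by apply: contraNneq ne => ->; rewrite dvdn0.
by rewrite (big_setD1 0) ?(subfield0 hK) //= expr0n (negPf e0) add0r (subfield_sum_expn hK).
Qed.

(** The map b -> x - b carries K without x onto K without 0. *)
Lemma subfield_prod_sub (F : finFieldType) (K : {set F}) (Q : nat) x :
  subfield_of_card K Q -> 2 \in [pchar F] -> x \in K ->
  \prod_(b in K :\ x) (x - b) = 1.
Proof.
move=> hK F2 xK; rewrite -[RHS](subfield_prod_eq1 hK F2).
have [[_ KB _] _] := hK.
rewrite [RHS](reindex_onto (fun b => x - b) (fun b => x - b)) /=; last first.
  by move=> b _; rewrite subKr.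
apply: eq_bigl => b; rewrite !inE subKr eqxx andbT subr_eq0 eq_sym.
case: eqP => //= _; apply/idP/idP => [bK|xbK]; first exact: KB.
by rewrite -(subKr x b) KB.
Qed.

(** The product of x - b over all b <> x in F is 1. Its part over nonzero b in K is 1/x, because the
    factor at b = 0 is x; the remaining part is therefore x. *)
Lemma prod_setD_subfield (F : finFieldType) (K : {set F}) (Q : nat) x :
  subfield_of_card K Q -> 2 \in [pchar F] -> x \in K :\ 0 ->
  \prod_(b in [set: F] :\: (K :\ 0)) (x - b) = x.
Proof.
move=> hK F2 xK0; have := xK0; rewrite !inE => /andP[x0 xK].
have hT : subfield_of_card [set: F] #|F|.
  by split; [split=> [|? ? _ _|? ? _ _]; rewrite inE | rewrite cardsT].
have := subfield_prod_sub hT F2 (finset.in_setT x).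
rewrite (big_setID (K :\ 0)) /=.
have -> : ([set: F] :\ x) :&: (K :\ 0) = (K :\ x) :\ 0.
  by apply/setP => y; rewrite !inE; case: (y == 0); case: (y == x).
have -> : ([set: F] :\ x) :\: (K :\ 0) = [set: F] :\: (K :\ 0).
  apply/setP => y; rewrite !inE; case: (eqVneq y x) => [->|_]; last by rewrite andbT.
  by rewrite x0 xK.
have := subfield_prod_sub hK F2 xK.
rewrite (big_setD1 0) /=; last by rewrite !inE eq_sym x0 (subfield0 hK).
rewrite subr0; set A := \prod_(i in _) _ => xA.
by move=> /(congr1 ( *%R x)); rewrite mulrA xA mul1r mulr1.
Qed.

(** * Numerical verification in the two situations *)

Lemma ndvdn_lt_double (M e : nat) :
  (0 < e < 2 * M)%N -> e != M -> ~~ (M %| e)%N.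
Proof.
move=> /andP[e0 e2] eM; apply/negP => /dvdnP[[|[|c]] E]; move: e0 e2 eM; rewrite E; nia.
Qed.

Theorem corollary4p5 (r m p : nat) (F : finFieldType) (K : {set F})
    (k t h n : nat) (eta : F) (alpha v : 'rV[F]_n)
    (hm : (0 < m)%N) (hr : (3 <= r)%N) (hrm : (r %| m)%N)
    (hp : prime p) (hF : #|F| = (p ^ m)%N)
    (hK : subfield_of_card K (p ^ r)%N)
    (hk : (3 <= k)%N) (ht : (1 <= t)%N) (hth : (t + h <= k - 1)%N)
    (heta : eta \notin K) (hkn : (k < n)%N)
    (halpha : eval_points alpha) (hv : multipliers v)
    (hAB :
      (* situation (A) *)
      [/\ n = (p ^ r)%N,
          [set alpha 0 j | j : 'I_n] = K,
          v = const_mx 1 &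
          [\/ t = 1%N /\ (2 * k + t + 2 = p ^ r)%N,
              [/\ odd t, (3 <= t)%N & (2 * k + t = p ^ r)%N],
              t = 2%N /\ (2 * k + t + 3 = p ^ r)%N |
              [/\ ~~ odd t, (4 <= t)%N & (2 * k + t + 1 = p ^ r)%N]]]
      \/
      (* situation (B) *)
      [/\ p = 2%N,
          n = (2 ^ r - 1)%N,
          [set alpha 0 j | j : 'I_n] = K :\ 0,
          (forall j : 'I_n,
             v 0 j = \prod_(beta in [set: F] :\: (K :\ 0))
                       (alpha 0 j - beta) ^+ (2 ^ (m - 1))) &
          [\/ t = 2%N /\ (2 * k + t + 3 = 2 ^ r - 1)%N,
              [/\ ~~ odd t, (4 <= t)%N & (2 * k + t + 1 = 2 ^ r - 1)%N],
              t = 1%N /\ (2 * k + t + 2 = 2 ^ r - 1)%N |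
              [/\ odd t, (3 <= t)%N & (2 * k + t = 2 ^ r - 1)%N]]]) :
  let C := eval_code (twisted_polys k t h eta) alpha v in
  [/\ ~ is_GRS C, self_orthogonal C & is_MDS C].
Proof.
move=> C.
have pF : p \in [pchar F] by apply: card_finPcharP hF hp.
have [phi phiE] := frobenius_power r pF.
have phi_eta : phi eta != eta by rewrite phiE (subfield_expP hK).
have eta0 : eta != 0 by apply: contraNneq heta => ->; apply: subfield0 hK.
pose N := (k - 1 + t)%N.
have hk' : (h < k)%N by lia.
have sum_points (g : F -> F) :
    \sum_j g (alpha 0 j) = \sum_(x in [set alpha 0 j | j : 'I_n]) g x.
  by rewrite big_imset //=; apply: in2W.
suff [alphaK kn t1n red2N [Z Z2]] : [/\ forall j, alpha 0 j \in K,
    (k - 1 + N < n)%N, t = 1%N -> (2 * k < n)%N,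
    exists2 e, (0 < e < n)%N & forall j, alpha 0 j ^+ (2 * N) = alpha 0 j ^+ e &
    (forall e, (e <= N + (k - 1))%N -> \sum_j v 0 j ^+ 2 * alpha 0 j ^+ e = 0) /\
    \sum_j v 0 j ^+ 2 * alpha 0 j ^+ (2 * N) = 0].
  have phi_alpha j : phi (alpha 0 j) = alpha 0 j by rewrite phiE (subfield_exp hK).
  split.
  - apply: twisted_nonGRS => // x.
    exact: (twisted_code_zeros phi_eta).
  - exact: twisted_self_orthogonal.
  - by apply: (twisted_MDS t phi_eta phi_alpha halpha hv); rewrite hk' ltnW.
have Q0 : (p ^ r)%:R = 0 :> F.
  by rewrite natrX (pcharf0 pF) expr0n; case: (r) hr.
case: hAB => [[nQ aK v1 cases]|[p2 nQ aK vE cases]].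
  have alphaK j : alpha 0 j \in K by rewrite -aK imset_f.
  have Q1 : ((p ^ r).-1).+1 = n by rewrite nQ prednK // expn_gt0 prime_gt0.
  have Z e : (e == 0%N) || ~~ ((p ^ r).-1 %| e)%N ->
      \sum_j v 0 j ^+ 2 * alpha 0 j ^+ e = 0.
    move=> He; rewrite -[RHS](subfield_sum_expn_char hK Q0 He) -[in RHS]aK -sum_points.
    by apply: eq_bigr => j _; rewrite v1 mxE expr1n mul1r.
  (* In the cases 2k + t = p^r and 2k + t + 1 = p^r, 2N = p^r - 1 would mean t = 1 and t = 2
     respectively, values that have their own equations. *)
  have arith : [/\ (k - 1 + N < (p ^ r).-1)%N, (2 * N < 2 * (p ^ r).-1)%N,
      (2 * N != (p ^ r).-1)%N & (0 < N)%N].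
    by rewrite /N; case: cases => [] []; split; lia.
  have [kN N2 NQ N0] := arith; split=> //.
  - lia.
  - by move=> t1; case: cases => [] []; lia.
  - have [lt|ge] := ltnP (2 * N) n; first by exists (2 * N)%N => //; lia.
    (* x^Q = x holds at 0 too, and 2N >= Q = n keeps the reduced exponent positive. *)
    exists (2 * N - (p ^ r).-1)%N; first by lia.
    move=> j; have -> : (2 * N = (2 * N - n) + p ^ r)%N by rewrite -nQ; lia.
    rewrite exprD (subfield_exp hK) // -exprSr; congr (_ ^+ _); lia.
  - split=> [e eN|]; apply: Z; last by rewrite ndvdn_lt_double ?orbT //; lia.
    by have [//|e0] := eqVneq e 0%N; rewrite ndvdn_lt_double //; lia.
subst p.
have alphaK j : alpha 0 j \in K :\ 0 by rewrite -aK imset_f.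
have Q1 : (2 ^ r).-1 = n by rewrite nQ subn1.
(* Squaring turns the exponent 2^(m-1) into 2^m = #|F|, which fixes every factor. *)
have v2 j : v 0 j ^+ 2 = alpha 0 j.
  rewrite vE -prodrXl -[RHS](prod_setD_subfield hK pF (alphaK j)).
  apply: eq_bigr => b _; rewrite -exprM -expnSr subn1 prednK //.
  by rewrite -hF expf_card.
have Z e : ~~ ((2 ^ r).-1 %| e.+1)%N ->
    \sum_j v 0 j ^+ 2 * alpha 0 j ^+ e = 0.
  move=> He; rewrite -[RHS](subfield_sum_expn hK He) -[in RHS]aK -sum_points.
  by apply: eq_bigr => j _; rewrite v2 exprS.
(* The weight v_j^2 = alpha_j shifts exponents, so 2N + 1 has to avoid n = Q - 1; 2N <> n keeps the
   reduced exponent 2N - n positive. *)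
have [kN N2 NQ N0] : [/\ (k + N < n)%N, ((2 * N).+1 < 2 * n)%N,
    (2 * N).+1 != n & (0 < N)%N /\ (2 * N)%N != n].
  by rewrite /N nQ; case: cases => [] []; split; lia.
split=> //.
- by move=> j; have := alphaK j; rewrite !inE => /andP[].
- lia.
- by move=> t1; case: cases => [] []; lia.
- have [lt|ge] := ltnP (2 * N) n; first by exists (2 * N)%N => //; lia.
  exists (2 * N - n)%N; first by lia.
  move=> j; have := subfield_exp1 hK (alphaK j); rewrite Q1 => an1.
  by rewrite -{1}(subnK ge) exprD an1 mulr1.
- split=> [e eN|]; apply: Z; rewrite ndvdn_lt_double //; lia.
Qed.
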